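(* Let $M$ be a domain (connected open subset) of $H^3$ in the upper half space model with coordinates $(x,y,z)$, $z>0$, and let $\sigma$ be a harmonic horospherical unit vector field on $M$, in standard form $$\sigma=\cos u\,\xi_1+\sin u\,\xi_2,$$ where $u$ is a smooth locally defined real-valued function. (i) If $u=u(x,y)$ (i.e. $u$ depends only on $x$ and $y$), then either $\sigma$ is invariant, or $\sigma=\hat{\boldsymbol\theta}$ up to translation in $H^3$. (ii) If $u=u(z)$ (i.e. $u$ depends only on $z$), then $\sigma$ is a member of the following 2-parameter family: $$\sigma_{p,q}=\cos(pz^2+q)\,\xi_1+\sin(pz^2+q)\,\xi_2,\qquad\text{where } p,q\in\mathbb R.$$
   Context: $H^3=\{(x,y,z):z>0\}$ with metric $ds^2=(dx^2+dy^2+dz^2)/z^2$ and Levi-Civita connection $\nabla$. The standard global orthonormal frame is $\xi_1=z\,\partial_x$, $\xi_2=z\,\partial_y$, $\xi_3=z\,\partial_z$. A unit vector field is horospherical if it is tangent to a foliation by horospheres, here (without loss of generality) the standard foliation with leaves $z=\text{const.}$; it can then be written $\sigma=\cos u\,\xi_1+\sin u\,\xi_2$ with $u$ smooth, locally defined, and unique up to adding integer multiples of $2\pi$. A smooth unit vector field $\sigma$ is harmonic if $\nabla^*\nabla\sigma=|\nabla\sigma|^2\sigma$, where $\nabla^*\nabla=-\mathrm{Tr}\,\nabla^2$. A horospherical unit field is invariant if it is a constant-coefficient combination of $\xi_1,\xi_2$, i.e. $u$ is constant. The field $\hat{\boldsymbol\theta}$ is defined on $H^3\smallsetminus L$, where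 $L$ is the $z$-axis $\{x=y=0\}$, by $$\hat{\boldsymbol\theta}=-\frac{y}{\sqrt{x^2+y^2}}\,\xi_1+\frac{x}{\sqrt{x^2+y^2}}\,\xi_2.$$ ''Up to translation'' means after applying a parabolic isometry $(x,y,z)\mapsto(x+a,y+b,z)$ with $a,b\in\mathbb R$ (and restricting to the relevant domain).
   Formalization: In (i) the conclusion also allows σ to be a translate of −θ̂: on H³∖L the field −θ̂ is a harmonic horospherical unit field with u = u(x,y) that is neither invariant nor a translate of θ̂. *)

(* Defs.v *)
From mathcomp Require Import all_boot all_order all_algebra.
From mathcomp Require Import all_classical all_reals all_analysis.

Set Implicit Arguments.
Unset Strict Implicit.
Unset Printing Implicit Defensive.

Import Order.TTheory GRing.Theory Num.Theory.
Import numFieldNormedType.Exports.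

Local Open Scope classical_set_scope.
Local Open Scope ring_scope.

(* Points of R^3 and tangent vectors are both row vectors; a tangent vector is
   given by its components in the coordinate basis d/dx, d/dy, d/dz.  Functions
   and vector fields are total on R^3, and only their values on the open set
   under consideration are ever constrained. *)

Section UpperHalfSpace.
Context {R : realType}.

Notation point := 'rV[R]_3.
Notation field := ('rV[R]_3 -> 'rV[R]_3).

Definition xc (p : point) : R := p 0 0.
Definition yc (p : point) : R := p 0 1.
Definition zc (p : point) : R := p 0 2.

Definition H3 : set point := [set p | 0 < zc p].

Definition evec (i : 'I_3) : point := delta_mx 0 i.

(* C^k in the sense of iterated partial derivatives. *)
Fixpoint Ck_on (W : normedModType R) (k : nat) (U : set point)
    (f : point -> W) : Prop :=
  match k with
  | 0 => forall p, U p -> {for p, continuous f}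
  | k'.+1 => (forall p, U p -> differentiable f p) /\
             (forall i : 'I_3, Ck_on k' U (fun p => 'D_(evec i) f p))
  end.

Definition smooth_on (W : normedModType R) (U : set point) (f : point -> W) :=
  forall k, Ck_on k U f.

Definition metric (p : point) : 'M[R]_3 := ((zc p ^+ 2)^-1)%:M.

Definition inner (p v w : point) : R := (v *m metric p *m w^T) 0 0.

Definition christoffel (k i j : 'I_3) (p : point) : R :=
  2^-1 * \sum_l invmx (metric p) k l *
    ('D_(evec i) (fun q => metric q j l) p
     + 'D_(evec j) (fun q => metric q i l) p
     - 'D_(evec l) (fun q => metric q i j) p).

(* nabla_X Y for the Levi-Civita connection. *)
Definition covD (X Y : field) : field := fun p =>
  'D_(X p) Y p
  + \row_k \sum_i \sum_j christoffel k i j p * X p 0 i * Y p 0 j.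

(* The second covariant derivative nabla^2_{X,Y} sigma. *)
Definition covD2 (X Y sigma : field) : field := fun p =>
  covD X (covD Y sigma) p - covD (covD X Y) sigma p.

Definition xi (i : 'I_3) : field := fun p => zc p *: evec i.

(* The trace of nabla^2 and the norm of nabla sigma are computed in the
   orthonormal frame xi. *)
Definition rough_laplacian (sigma : field) : field := fun p =>
  - \sum_i covD2 (xi i) (xi i) sigma p.

Definition covD_norm2 (sigma : field) (p : point) : R :=
  \sum_i inner p (covD (xi i) sigma p) (covD (xi i) sigma p).

Definition unit_field (M : set point) (sigma : field) :=
  forall p, M p -> inner p (sigma p) (sigma p) = 1.

Definition harmonic_unit_field (M : set point) (sigma : field) :=
  [/\ smooth_on M sigma, unit_field M sigma &
      forall p, M p -> rough_laplacian sigma p = covD_norm2 sigma p *: sigma p].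

(* Tangency to the horospheres z = const. *)
Definition horospherical (M : set point) (sigma : field) :=
  unit_field M sigma /\ forall p, M p -> zc (sigma p) = 0.

Definition angle_on (U : set point) (sigma : field) (u : point -> R) :=
  smooth_on U u /\
  forall p, U p -> sigma p = cos (u p) *: xi 0 p + sin (u p) *: xi 1 p.

(* sigma has, near every point of M, an angle function with property Q. *)
Definition locally_angle (Q : set point -> (point -> R) -> Prop)
    (M : set point) (sigma : field) :=
  forall p, M p -> exists (U : set point) (u : point -> R),
    [/\ open U, U p, U `<=` M, angle_on U sigma u & Q U u].

Definition depends_only_on_xy (U : set point) (u : point -> R) :=
  exists v : R -> R -> R, forall p, U p -> u p = v (xc p) (yc p).

Definition depends_only_on_z (U : set point) (u : point -> R) :=
  exists v : R -> R, forall p, U p -> u p = v (zc p).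

Definition invariant_field (M : set point) (sigma : field) :=
  exists a b : R, forall p, M p -> sigma p = a *: xi 0 p + b *: xi 1 p.

Definition zaxis : set point := [set p | xc p = 0 /\ yc p = 0].

(* Both theta_hat and its opposite are harmonic horospherical unit fields off the
   z-axis, with angle functions independent of z, and neither is a translate of
   the other. *)
Definition theta_hat : field := fun p =>
  - (yc p / Num.sqrt (xc p ^+ 2 + yc p ^+ 2)) *: xi 0 p
  + (xc p / Num.sqrt (xc p ^+ 2 + yc p ^+ 2)) *: xi 1 p.

Definition translation (a b : R) (p : point) : point :=
  p + a *: evec 0 + b *: evec 1.

(* Push-forward of a field by a translation, whose differential is the identity
   in the coordinate basis. *)
Definition translate_field (a b : R) (sigma : field) : field := fun p =>
  sigma (translation (- a) (- b) p).

(* On M, sigma is the restriction of a translate of tau, where tau is defined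
   off the z-axis. *)
Definition translate_of (tau : field) (M : set point) (sigma : field) :=
  exists a b : R,
    M `<=` ~` (translation a b @` zaxis) /\
    forall p, M p -> sigma p = translate_field a b tau p.

Definition sigma_pq (p q : R) : field := fun m =>
  cos (p * zc m ^+ 2 + q) *: xi 0 m + sin (p * zc m ^+ 2 + q) *: xi 1 m.

End UpperHalfSpace.

(* Main.v *)
Require Import Defs.
From mathcomp Require Import all_boot all_order all_algebra.
From mathcomp Require Import all_classical all_reals all_analysis.
From mathcomp Require Import ring lra.

(** A horospherical field is [sigma = c xi_0 + s xi_1] with [c = cos u] and
    [s = sin u].  Working with the globally defined smooth coefficients [c], [s]
    instead of the local angles [u] makes the whole argument global on [M].

    In the orthonormal frame [xi] the hyperbolic connection has constant
    coefficients, so covariant derivatives act on triples of coefficient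
    functions ([covD_frame]).  Harmonicity then splits ([harmonic_system]): the
    component along [xi_2] says that [(c, s)] is divergence free in the plane,
    [c_x + s_y = 0], and the other two say that [(c, s)] solves the harmonic
    map equation
    [z (c_xx + c_yy + c_zz) - c_z = - z (|grad c|^2 + |grad s|^2) c],
    and likewise for [s].

    (i) If nothing depends on [z], then [(c, s)] is a planar unit field [T].
    Being divergence free, it is determined to first order by its curl
    [l = s_x - c_y], the curvature of its integral curves, and with the normal
    [N = (-s, c)] the harmonic map equation becomes [grad l = l^2 N].  The
    centre of curvature of the integral curve through [P] is [P + N / l], with
    homogeneous coordinates [(l : l P + N)].  All three of these functions have
    the same logarithmic derivative [l N], and they never vanish together; hence
    their ratios are constant ([common_rate_proportional]).  So either [l]
    vanishes everywhere and [T] is constant, or all integral curves are arcs of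
    circles with one common centre, run through in one direction: [sigma] is a
    translate of [theta_hat] or of its opposite.

    (ii) If [c] and [s] depend only on [z], the twist [w = c s_z - s c_z], which
    is the derivative of the angle, satisfies [w_z = w / z].  Hence [w = 2 a z]
    for a constant [a], and rotating [(c, s)] back by the angle [a z^2] gives a
    constant vector [(cos q, sin q)].

    Two general facts are used throughout: a function with zero gradient is
    constant on a connected open set ([gradient0_constant]), and mixed second
    partial derivatives of a smooth function agree ([mixed_derivatives]). *)

Set Implicit Arguments.
Unset Strict Implicit.
Unset Printing Implicit Defensive.

Import Order.TTheory GRing.Theory Num.Theory.
Import numFieldNormedType.Exports.

Local Open Scope classical_set_scope.
Local Open Scope ring_scope.

(** * Directional derivatives in a normed space *)

Section DirectionalDerivatives.
Context {R : realType} {V : normedModType R}.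
Implicit Types (f g : V -> R) (p v : V).

Lemma derive_of f p v d e : is_derive p v f d -> d = e -> 'D_v f p = e.
Proof. by move=> [_ <-]. Qed.

Lemma is_derive_diff f p v : differentiable f p -> is_derive p v f ('D_v f p).
Proof. by move=> df; apply: DeriveDef => //; exact: diff_derivable. Qed.

Lemma is_derive_const (a : R) p v : is_derive p v (fun=> a) 0.
Proof. exact: is_derive_cst. Qed.

Lemma is_derive_add f g p v df dg : is_derive p v f df -> is_derive p v g dg ->
  is_derive p v (fun q => f q + g q) (df + dg).
Proof. exact: is_deriveD. Qed.

Lemma is_derive_opp f p v df : is_derive p v f df ->
  is_derive p v (fun q => - f q) (- df).
Proof. exact: is_deriveN. Qed.

Lemma is_derive_mul f g p v df dg : is_derive p v f df -> is_derive p v g dg ->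
  is_derive p v (fun q => f q * g q) (f p * dg + g p * df).
Proof. exact: is_deriveM. Qed.

Lemma is_derive_sqr f p v df : is_derive p v f df ->
  is_derive p v (fun q => f q ^+ 2) (2 * f p * df).
Proof. by move=> h; apply: is_derive_eq (is_derive_mul h h) _; ring. Qed.

Lemma is_derive_inv f p v df : f p != 0 -> is_derive p v f df ->
  is_derive p v (fun q => (f q)^-1) (- (f p) ^- 2 * df).
Proof.
move=> f0 [h <-]; apply: DeriveDef; first exact: derivableV.
by rewrite deriveV.
Qed.


(** Differentiating along a line turns a directional derivative into an
    ordinary one, to which the one-variable mean value theorem applies. *)
Lemma is_derive_line f p v (t d : R) : is_derive (t *: v + p) v f d ->
  is_derive t 1 (fun h : R => f (h *: v + p)) d.
Proof.
have E : (fun h : R => h^-1 *: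
     (((fun h : R => f (h *: v + p)) \o shift t) (h *: (1 : R^o)) -
      f (t *: v + p))) =
   (fun h : R => h^-1 *: ((f \o shift (t *: v + p)) (h *: v) - f (t *: v + p))).
  by apply/funext => h /=; rewrite scalerDl addrA [h *: 1]mulr1.
by move=> [fp <-]; split; rewrite ?/derivable ?/derive E.
Qed.

Lemma is_derive_line0 f p v (d : R) :
  is_derive (0 : R) 1 (fun h : R => f (h *: v + p)) d -> is_derive p v f d.
Proof.
have E : (fun h : R => h^-1 *:
     (((fun h : R => f (h *: v + p)) \o shift 0) (h *: (1 : R^o)) -
      f (0 *: v + p))) =
   (fun h : R => h^-1 *: ((f \o shift p) (h *: v) - f p)).
  by apply/funext => h /=; rewrite addr0 scale0r add0r [h *: 1]mulr1.
by move=> []; rewrite /derivable /derive E.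
Qed.

Lemma is_derive_chain (g : R -> R) f p v df dg : is_derive p v f df ->
  is_derive (f p) 1 g dg -> is_derive p v (fun q => g (f q)) (dg * df).
Proof.
move=> hf hg; apply: is_derive_line0.
have hl : is_derive (0:R) 1 (fun h : R => f (h *: v + p)) df.
  by apply: is_derive_line; rewrite scale0r add0r.
apply: (@is_derive1_comp R g (fun h : R => f (h *: v + p))).
by rewrite scale0r add0r.
Qed.

Lemma MVT_line f p v (h : R) : 0 < h ->
  (forall t, 0 <= t <= h -> derivable f (t *: v + p) v) ->
  exists2 t, 0 <= t <= h & f (h *: v + p) - f p = h * 'D_v f (t *: v + p).
Proof.
move=> h0 fd.
have fl t : 0 <= t <= h ->
    is_derive t 1 (fun s : R => f (s *: v + p)) ('D_v f (t *: v + p)).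
  by move=> /fd tf; apply/is_derive_line/derivableP.
have [||t th] := @MVT_segment R (fun s => f (s *: v + p))
  (fun t => 'D_v f (t *: v + p)) 0 h (ltW h0).
- by move=> t; rewrite in_itv /= => /andP[t0 th]; apply: fl; rewrite !ltW.
- apply: derivable_within_continuous => t; rewrite in_itv /= => th.
  by have [] := fl _ th.
- rewrite subr0 scale0r add0r mulrC => e.
  by exists t => //; move: th; rewrite in_itv.
Qed.


(** The mean value theorem is applied along [u] to the increment of [f] in the
    direction [v], and then along [v] to ['D_u f]. *)
Lemma second_difference f p u v (h : R) : 0 < h ->
  (forall s t : R, 0 <= s <= h -> 0 <= t <= h ->
    differentiable f (s *: u + (t *: v + p))) ->
  (forall s t : R, 0 <= s <= h -> 0 <= t <= h ->
    differentiable ('D_u f) (s *: u + (t *: v + p))) ->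
  exists s t : R, [/\ 0 <= s <= h, 0 <= t <= h &
    f (h *: u + (h *: v + p)) - f (h *: u + p) - f (h *: v + p) + f p =
      h * (h * 'D_v ('D_u f) (s *: u + (t *: v + p)))].
Proof.
move=> h0 df ddf; have hh : 0 <= h <= h by rewrite lexx ltW.
have h00 : 0 <= (0 : R) <= h by rewrite lexx ltW.
pose g q := f (h *: v + q) - f q.
have gd (t : R) : 0 <= t <= h ->
  is_derive (t *: u + p) u g
    ('D_u f (t *: u + (h *: v + p)) - 'D_u f (t *: u + p)).
  move=> th; apply: is_derive_add; last first.
    apply/is_derive_opp/is_derive_diff.
    by have := df _ _ th h00; rewrite scale0r add0r.
  have sh (a b c : V) : a + (b + c) = b + (a + c) by rewrite addrCA.
  have [] := is_derive_diff u (df _ _ th hh); set d := 'D_u f _ => fd fe.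
  apply: is_derive_line0.
  have -> : (fun k : R => f (h *: v + (k *: u + (t *: u + p)))) =
            (fun k : R => f (k *: u + (t *: u + (h *: v + p)))).
    by apply/funext => k; congr f; rewrite sh; congr (_ + _); exact: sh.
  by apply: is_derive_line; rewrite scale0r add0r.
have [s sh] := MVT_line h0 (fun t th => @ex_derive _ _ _ _ _ _ _ (gd t th)).
rewrite (@derive_val _ _ _ _ _ _ _ (gd s sh)) /g => e1.
have [t th|t th e2] := @MVT_line ('D_u f) (s *: u + p) v h h0.
  by apply: diff_derivable; rewrite addrCA; exact: ddf.
exists s, t; split=> //; rewrite (addrCA (s *: u)) -e2.
rewrite (addrCA (h *: v)) -e1 (addrCA (h *: v)).
by ring.
Qed.

(** The second difference of [f] on a parallelogram of side [h] is symmetric in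
    [u] and [v].  It equals [h^2] times a value of either mixed derivative at
    points tending to [p]; continuity of both at [p] concludes. *)
Theorem mixed_derivatives f p u v : (\forall q \near p, differentiable f q) ->
  (\forall q \near p, differentiable ('D_u f) q) ->
  (\forall q \near p, differentiable ('D_v f) q) ->
  {for p, continuous ('D_u ('D_v f))} -> {for p, continuous ('D_v ('D_u f))} ->
  'D_u ('D_v f) p = 'D_v ('D_u f) p.
Proof.
move=> df du dv cuv cvu; apply/eqP; rewrite -subr_eq0 -normr_eq0.
apply/eqP/le_anti; rewrite normr_ge0 andbT; apply/ler_addgt0Pr => e e0.
rewrite add0r.
have e20 : 0 < e / 2 by rewrite divr_gt0.
have near1 : \forall q \near p, [/\ differentiable f q,
   differentiable ('D_u f) q, differentiable ('D_v f) q,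
   `|'D_u ('D_v f) p - 'D_u ('D_v f) q| < e / 2 &
   `|'D_v ('D_u f) p - 'D_v ('D_u f) q| < e / 2].
  have ncuv : \forall q \near p, `|'D_u ('D_v f) p - 'D_u ('D_v f) q| < e / 2.
    by move/cvgrPdist_lt : cuv; apply.
  have ncvu : \forall q \near p, `|'D_v ('D_u f) p - 'D_v ('D_u f) q| < e / 2.
    by move/cvgrPdist_lt : cvu; apply.
  apply: filterS (filterI df (filterI du (filterI dv (filterI ncuv ncvu)))).
  by move=> q [? [? [? [? ?]]]]; split.
have [r /= r0 br] := (nbhs_ballP _ _).1 near1.
(* small enough for the parallelogram of side [h] to lie in the ball *)
pose h := r / (2 * (`|u| + `|v| + 1)).
have d0 : 0 < `|u| + `|v| + 1 by rewrite ltr_wpDl // addr_ge0.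
have h0 : 0 < h by rewrite divr_gt0 // mulr_gt0.
have inb (s t : R) : 0 <= s <= h -> 0 <= t <= h ->
    ball p r (s *: u + (t *: v + p)).
  move=> /andP[s0 sh] /andP[t0 th].
  rewrite -ball_normE /= addrA opprD addrCA subrr addr0.
  rewrite normrN (le_lt_trans (ler_normD _ _)) // !normrZ !ger0_norm //.
  rewrite (@le_lt_trans _ _ (h * (`|u| + `|v|))) //.
    by rewrite mulrDr lerD // ler_wpM2r.
  rewrite (@lt_le_trans _ _ (h * (2 * (`|u| + `|v| + 1)))) //.
    rewrite ltr_pM2l //; have := normr_ge0 u; have := normr_ge0 v; lra.
  by rewrite /h divfK // mulf_neq0 // gt_eqF.
have inb' (s t : R) : 0 <= s <= h -> 0 <= t <= h ->
    ball p r (s *: v + (t *: u + p)).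
  by move=> sh th; rewrite addrCA; exact: inb.
have [s1 [t1 [s1h t1h e1]]] : exists s t : R, [/\ 0 <= s <= h, 0 <= t <= h &
    f (h *: u + (h *: v + p)) - f (h *: u + p) - f (h *: v + p) + f p =
      h * (h * 'D_v ('D_u f) (s *: u + (t *: v + p)))].
  apply: second_difference => // s t sh th.
    by have [] := br _ (inb _ _ sh th).
  by have [] := br _ (inb _ _ sh th).
have [s2 [t2 [s2h t2h e2]]] : exists s t : R, [/\ 0 <= s <= h, 0 <= t <= h &
    f (h *: v + (h *: u + p)) - f (h *: v + p) - f (h *: u + p) + f p =
      h * (h * 'D_u ('D_v f) (s *: v + (t *: u + p)))].
  apply: second_difference => // s t sh th.
    by have [] := br _ (inb' _ _ sh th).
  by have [] := br _ (inb' _ _ sh th).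
have [_ _ _ _ l1] := br _ (inb _ _ s1h t1h).
have [_ _ _ l2 _] := br _ (inb' _ _ s2h t2h).
(* the same second difference is computed in the two orders *)
have E : 'D_v ('D_u f) (s1 *: u + (t1 *: v + p)) =
         'D_u ('D_v f) (s2 *: v + (t2 *: u + p)).
  apply: (mulfI (lt0r_neq0 h0)); apply: (mulfI (lt0r_neq0 h0)).
  by rewrite -e1 -e2 (addrCA (h *: v)); congr (_ + _); rewrite addrAC.
have tri (a b c d : R) : `|b - c| < d / 2 -> `|a - c| < d / 2 -> `|a - b| <= d.
  by clear; rewrite distrC => bc ac; have := ler_distD c a b; lra.
by apply: tri l2; rewrite -E.
Qed.

End DirectionalDerivatives.

(** * Functions on a connected open set *)

Section Connectedness.
Context {R : realType} {V : normedModType R}.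

(** A level set of a locally constant function is open and closed in [M]. *)
Lemma locally_constant (T : Type) (M : set V) (f : V -> T) : connected M ->
  open M -> (forall p, M p -> \forall q \near p, f q = f p) ->
  forall p q, M p -> M q -> f p = f q.
Proof.
move=> cM oM lc p q Mp Mq.
have op (P : set T) : open (M `&` f @^-1` P).
  rewrite openE => x [Mx Px]; apply: filterI; first exact: open_nbhs_nbhs.
  by apply: filterS (lc x Mx) => y /= ->.
have : M `&` f @^-1` [set f p] = M.
  apply: cM; first by exists p.
    by exists (M `&` f @^-1` [set f p]) => //; rewrite setIA setIid.
  exists (~` (M `&` f @^-1` (~` [set f p]))).
    exact/open_closedC/op.
  by rewrite setCI setIUr setICr set0U preimage_setC setCK.
by move/seteqP => [_ /(_ _ Mq)] [].
Qed.

Lemma gradient0_constant (M : set V) (f : V -> R) : connected M -> open M ->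
  (forall p v, M p -> is_derive p v f 0) ->
  forall p q, M p -> M q -> f p = f q.
Proof.
move=> cM oM df; apply: locally_constant => // p Mp.
have [r /= r0 br] := (nbhs_ballP _ _).1 (open_nbhs_nbhs (conj oM Mp)).
apply/nbhs_ballP; exists r => //= q; rewrite -ball_normE /= => pq.
have seg t : 0 <= t <= (1 : R) -> M (t *: (q - p) + p).
  move=> /andP[t0 t1]; apply: br.
  rewrite -ball_normE /= opprD addrCA subrr addr0.
  by rewrite normrN normrZ ger0_norm // distrC (le_lt_trans _ pq) // ler_piMl.
have [t th|t th] := @MVT_line _ _ f p (q - p) 1 ltr01.
  exact: (@ex_derive _ _ _ _ _ _ _ (df _ (q - p) (seg _ th))).
rewrite scale1r subrK (@derive_val _ _ _ _ _ _ _ (df _ (q - p) (seg _ th))).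
by rewrite mulr0 => /eqP; rewrite subr_eq0 => /eqP.
Qed.

(** If all the [W j] grow at the same rate [w] in every direction, so does the
    Euclidean norm [n] of the vector [W]; the normalised vector [W / n]
    therefore has zero gradient.  Dividing by [n] rather than by one of the
    [W j] avoids any assumption on where each of them vanishes, and positivity
    of [n] makes the proportionality preserve signs. *)
Lemma common_rate_proportional (M : set V) m
    (W : 'I_m -> V -> R) :
  connected M -> open M ->
  (forall p v, M p ->
     exists w : R, forall j, is_derive p v (W j) (w * W j p)) ->
  (forall p, M p -> exists j, W j p != 0) ->
  exists (n : V -> R) (k : 'I_m -> R),
    forall p, M p -> 0 < n p /\ forall j, W j p = n p * k j.
Proof.
move=> cM oM dW W0; pose N p := \sum_j W j p ^+ 2.
have N0 p : M p -> 0 < N p.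
  move=> /W0 [j Wj]; rewrite /N (bigD1 j) //=.
  by rewrite ltr_pwDl ?exprn_even_gt0 //= sumr_ge0 // => i _; exact: sqr_ge0.
pose n p := Num.sqrt (N p).
have n0 p : M p -> 0 < n p by move=> Mp; rewrite sqrtr_gt0; exact: N0.
have dn p v : M p -> exists w : R, is_derive p v n (w * n p) /\
   forall j, is_derive p v (W j) (w * W j p).
  move=> Mp; have [w dw] := dW p v Mp; exists w; split=> //.
  have dN : is_derive p v N (\sum_j 2 * W j p * (w * W j p)).
    have -> : N = \sum_j (fun p => W j p ^+ 2).
      by apply/funext => q; rewrite fct_sumE.
    by apply: is_derive_sum => j; exact: is_derive_sqr.
  have h := is_derive_chain dN (is_derive1_sqrt (N0 p Mp)).
  apply: (is_derive_eq h); clear h.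
  have -> : \sum_j 2 * W j p * (w * W j p) = 2 * w * N p.
    by rewrite /N mulr_sumr; apply: eq_bigr => j _; ring.
  rewrite -/(n p) -[N p]sqr_sqrtr ?ltW ?N0 // -/(n p).
  by have := lt0r_neq0 (n0 p Mp); move: (n p) => x x0; field.
have [[p0 Mp0]|M0] := pselect (M !=set0); last first.
  by exists n, (fun=> 0) => p Mp; case: M0; exists p.
exists n, (fun j => W j p0 / n p0) => p Mp; split; first exact: n0.
move=> j; pose g q := W j q * (n q)^-1.
suff -> : W j p0 / n p0 = g p by rewrite mulrCA mulfV ?mulr1 // lt0r_neq0 // n0.
apply: (gradient0_constant cM oM) => // q v Mq.
have [w [dnq dWq]] := dn q v Mq; have nq : n q != 0 by exact/lt0r_neq0/n0.
apply: (is_derive_eq (is_derive_mul (dWq j) (is_derive_inv nq dnq))).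
by move: (n q) (W j q) nq => x y x0; field.
Qed.

Lemma near_eq_differentiable (W : normedModType R) (f g : V -> W) (p : V) :
  (\forall q \near p, f q = g q) -> differentiable f p -> differentiable g p.
Proof.
move=> fg /diff_locallyP [fc fe]; have fgp : f p = g p := nbhs_singleton fg.
have ge : g \o shift p = cst (g p) + 'd f p +o_ 0 id.
  apply/eqaddoP => e e0; move/eqaddoP : fe => /(_ e e0).
  have fg0 : \forall h \near (0 : V), f (h + p) = g (h + p).
    by move: fg; rewrite (near_shift 0); apply: filterS => h /=; rewrite subr0.
  apply: filter_app; apply: filterS fg0 => h /= fgh.
  by rewrite !fctE /= /shift fgh fgp.
by apply/diff_locallyP; rewrite (diff_unique fc ge).
Qed.

Lemma near_eq_continuous (W : topologicalType) (f g : V -> W) (p : V) :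
  (\forall q \near p, f q = g q) -> {for p, continuous f} ->
  {for p, continuous g}.
Proof.
move=> fg fc; have fgp : f p = g p := nbhs_singleton fg.
suff : g @ p --> g p by []; rewrite -fgp.
by apply: cvg_trans fc; exact: near_eq_cvg.
Qed.

End Connectedness.

(** * Smooth functions on an open subset of three-space *)

Section Smooth.
Context {R : realType}.
Notation point := 'rV[R]_3.
Implicit Types (U : set point) (f g : point -> R) (p : point).

(** A name for the partial derivative: it can be generalised to an arbitrary
    operator before an arithmetic tactic, which keeps the goals small. *)
Definition partial (i : 'I_3) (f : point -> R) : point -> R := 'D_(evec i) f.

Lemma open_near U (P : point -> Prop) p : open U -> U p ->
  (forall q, U q -> P q) -> \forall q \near p, P q.
Proof. by move=> oU Up UP; apply: filterS UP _; exact: open_nbhs_nbhs. Qed.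

Section SmoothW.
Context {W : normedModType R}.
Implicit Type h : point -> W.

Lemma Ck_on_eq k U h h' : open U ->
  (forall p, U p -> h p = h' p) -> Ck_on k U h -> Ck_on k U h'.
Proof.
move=> oU; elim: k h h' => [|k IH] f g fg.
  by move=> fc p Up; apply: near_eq_continuous (fc p Up); exact: open_near fg.
move=> [fd fdd]; split=> [p Up|i].
  by apply: near_eq_differentiable (fd p Up);
    exact: open_near fg.
apply: IH (fdd i) => p Up.
by apply: near_eq_derive; exact: open_near fg.
Qed.

Lemma Ck_on_S k U h : Ck_on k.+1 U h -> Ck_on k U h.
Proof.
elim: k h => [|k IH] f [fd fdd].
  by move=> p Up; exact/differentiable_continuous/fd.
by split=> // i; apply: IH.
Qed.

Lemma smooth_diff U h p : smooth_on U h -> U p -> differentiable h p.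
Proof. by move=> /(_ 1%N) [+ _]; apply. Qed.

Lemma smooth_deriv U h i : smooth_on U h -> smooth_on U ('D_(evec i) h).
Proof. by move=> sf k; have [_] := sf k.+1; apply. Qed.

Lemma smooth_eq U h h' : open U -> (forall p, U p -> h p = h' p) ->
  smooth_on U h -> smooth_on U h'.
Proof. by move=> oU hh sh k; exact: Ck_on_eq (sh k). Qed.

End SmoothW.

Lemma Ck_on_cst k U (a : R) : Ck_on k U (fun=> a).
Proof.
elim: k a => [|k IH] a; first by move=> p _; exact: cst_continuous.
split=> [p _|i]; first exact: differentiable_cst.
have -> : 'D_(evec i) (fun=> a) = (fun=> 0) :> (point -> R).
  by apply/funext => p; rewrite derive_cst.
exact: IH.
Qed.

Lemma Ck_onD k U f g : open U -> Ck_on k U f -> Ck_on k U g ->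
  Ck_on k U (fun p => f p + g p).
Proof.
move=> oU; elim: k f g => [|k IH] f g.
  by move=> fc gc p Up; apply: continuousD; [exact: fc|exact: gc].
move=> [fd fdd] [gd gdd]; split=> [p Up|i].
  by apply: differentiableD; [exact: fd|exact: gd].
apply: Ck_on_eq (IH _ _ (fdd i) (gdd i)) => // p Up.
apply/esym/derive_of/erefl/is_derive_add; apply: is_derive_diff.
  exact: fd.
exact: gd.
Qed.

Lemma Ck_onM k U f g : open U -> Ck_on k U f -> Ck_on k U g ->
  Ck_on k U (fun p => f p * g p).
Proof.
move=> oU; elim: k f g => [|k IH] f g.
  by move=> fc gc p Up; apply: continuousM; [exact: fc|exact: gc].
move=> Cf Cg; have [fd fdd] := Cf; have [gd gdd] := Cg; split=> [p Up|i].
  by apply: differentiableM; [exact: fd|exact: gd].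
apply: Ck_on_eq (Ck_onD oU (IH _ _ (Ck_on_S Cf) (gdd i))
  (IH _ _ (Ck_on_S Cg) (fdd i))) => // p Up.
apply/esym/derive_of/erefl/is_derive_mul; apply: is_derive_diff.
  exact: fd.
exact: gd.
Qed.

Lemma Ck_onV k U f : open U -> (forall p, U p -> f p != 0) -> Ck_on k U f ->
  Ck_on k U (fun p => (f p)^-1).
Proof.
move=> oU f0; elim: k => [|k IH] Cf.
  by move=> p Up; apply: continuousV; [exact: f0|exact: Cf].
have [fd fdd] := Cf; split=> [p Up|i].
  by apply: differentiableV; [exact: fd|exact: f0].
have Cv := IH (Ck_on_S Cf).
apply: Ck_on_eq (Ck_onM oU (Ck_on_cst k U (-1))
  (Ck_onM oU (Ck_onM oU Cv Cv) (fdd i))) => // p Up.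
apply/esym/derive_of.
  by apply: is_derive_inv; [exact: f0|exact/is_derive_diff/fd].
by rewrite -exprVn mulN1r mulNr expr2.
Qed.

Lemma smooth_cst U (a : R) : smooth_on U (fun=> a).
Proof. by move=> k; exact: Ck_on_cst. Qed.

Lemma smoothD U f g : open U -> smooth_on U f -> smooth_on U g ->
  smooth_on U (fun p => f p + g p).
Proof. by move=> oU sf sg k; exact: Ck_onD. Qed.

Lemma smoothM U f g : open U -> smooth_on U f -> smooth_on U g ->
  smooth_on U (fun p => f p * g p).
Proof. by move=> oU sf sg k; exact: Ck_onM. Qed.

Lemma smoothN U f : open U -> smooth_on U f -> smooth_on U (fun p => - f p).
Proof.
move=> oU sf; apply: smooth_eq (smoothM oU (smooth_cst U (-1)) sf) => // p Up.
by rewrite mulN1r.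
Qed.

Lemma smoothV U f : open U -> (forall p, U p -> f p != 0) -> smooth_on U f ->
  smooth_on U (fun p => (f p)^-1).
Proof. by move=> oU f0 sf k; exact: Ck_onV. Qed.

Lemma is_derive_entry (V : normedModType R) (Y : V -> point) (p v : V) k :
  differentiable Y p -> is_derive p v (fun q => Y q 0 k) ('D_v Y p 0 k).
Proof.
move=> Yd; have Yv : derivable Y p v by exact: diff_derivable.
rewrite derive_mx // mxE; apply: DeriveDef => //.
by have /derivable_mxP := Yv; apply.
Qed.

Lemma differentiable_entry (V : normedModType R) (Y : V -> point) (p : V) k :
  differentiable Y p -> differentiable (fun q => Y q 0 k) p.
Proof.
move=> Yd.
apply: (@differentiable_comp _ _ _ _ Y (fun N : point => N 0 k)) => //.
exact: differentiable_coord.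
Qed.

Lemma smooth_entry U (Y : point -> point) k : open U -> smooth_on U Y ->
  smooth_on U (fun p => Y p 0 k).
Proof.
move=> oU sY n; elim: n Y sY => [|n IH] Y sY.
  move=> p Up; apply: differentiable_continuous.
  exact/differentiable_entry/(smooth_diff sY).
split=> [p Up|i]; first exact/differentiable_entry/(smooth_diff sY).
apply: Ck_on_eq (IH _ (smooth_deriv i sY)) => // p Up.
exact/esym/derive_of/erefl/is_derive_entry/(smooth_diff sY).
Qed.

Lemma is_derive_coord p v k : is_derive p v (fun q : point => q 0 k) (v 0 k).
Proof.
have := @is_derive_entry _ id p v k; rewrite derive_id; apply.
exact: ex_diff.
Qed.

Lemma smooth_coord U k : smooth_on U (fun p : point => p 0 k).
Proof.
case=> [|n].
  by move=> p Up; exact/differentiable_continuous/differentiable_coord.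
split=> [p Up|i]; first exact: differentiable_coord.
have -> : 'D_(evec i) (fun p : point => p 0 k) = (fun=> evec i 0 k).
  by apply/funext => p; apply: derive_of (is_derive_coord _ _ _) _.
exact: Ck_on_cst.
Qed.

Lemma partial_of i f p d e : is_derive p (evec i) f d -> d = e ->
  partial i f p = e.
Proof. exact: derive_of. Qed.

Lemma smooth_partial U i f : smooth_on U f -> smooth_on U (partial i f).
Proof. exact: smooth_deriv. Qed.

Lemma partial_eq U i f g p : open U -> U p -> (forall q, U q -> f q = g q) ->
  partial i f p = partial i g p.
Proof. by move=> oU Up fg; apply: near_eq_derive; exact: open_near fg. Qed.

Lemma partial_cst i (a : R) p : partial i (fun=> a) p = 0.
Proof. exact: derive_cst. Qed.

Lemma mixed_partials U f i j p : open U -> smooth_on U f -> U p ->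
  partial i (partial j f) p = partial j (partial i f) p.
Proof.
move=> oU sf Up.
have near_diff h : smooth_on U h -> \forall q \near p, differentiable h q.
  by move=> sh; apply: open_near oU Up _ => q; exact: smooth_diff.
apply: mixed_derivatives.
- exact: near_diff.
- exact/near_diff/smooth_partial.
- exact/near_diff/smooth_partial.
- apply/differentiable_continuous/(smooth_diff _ Up).
  exact/smooth_partial/smooth_partial.
- apply/differentiable_continuous/(smooth_diff _ Up).
  exact/smooth_partial/smooth_partial.
Qed.

Lemma derive_partials f p v : differentiable f p ->
  'D_v f p = \sum_i v 0 i * partial i f p.
Proof.
move=> df; rewrite [v in LHS]row_sum_delta deriveE // linear_sum.
by apply: eq_bigr => i _; rewrite linearZ /= /partial deriveE.
Qed.

Lemma partials0_constant U f : connected U -> open U ->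
  (forall p, U p -> differentiable f p) ->
  (forall i p, U p -> partial i f p = 0) ->
  forall p q, U p -> U q -> f p = f q.
Proof.
move=> cU oU df pf; apply: gradient0_constant => // p v Up.
apply: is_derive_eq (is_derive_diff v (df p Up)) _.
by rewrite derive_partials ?big1 // => [i _|]; [rewrite pf ?mulr0|exact: df].
Qed.

End Smooth.

(** * The Levi-Civita connection in the orthonormal frame *)

Section Geometry.
Context {R : realType}.
Notation point := 'rV[R]_3.
Implicit Types (p v : point) (C D : 'I_3 -> point -> R).

Definition frame_field C : point -> point :=
  fun p => \sum_k C k p *: xi k p.

(** For [i] = 0, 1 the frame satisfies [nabla_{xi i} xi i = xi 2] and
    [nabla_{xi i} xi 2 = - xi i], all other derivatives of its members being
    zero: these are the two correction terms.  For [i = k = 2] they cancel. *)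
Definition frame_covD (i : 'I_3) C : 'I_3 -> point -> R := fun k p =>
  zc p * partial i (C k) p
  + (k == 2)%:R * C i p - (k == i)%:R * C 2 p.

Lemma evecE (i k : 'I_3) : (evec i : point) 0 k = (k == i)%:R.
Proof. by rewrite mxE eqxx. Qed.

Lemma ord3P (P : 'I_3 -> Prop) : P 0 -> P 1 -> P 2 -> forall i, P i.
Proof.
move=> P0 P1 P2 [[|[|[|i]]] hi] //.
- by have -> : Ordinal hi = 0 by exact: val_inj.
- by have -> : Ordinal hi = 1 by exact: val_inj.
- by have -> : Ordinal hi = 2 by exact: val_inj.
Qed.

Lemma sum3E (A : nmodType) (F : 'I_3 -> A) : \sum_i F i = F 0 + F 1 + F 2.
Proof.
rewrite !big_ord_recl big_ord0 addr0 addrA; congr (_ + F _ + F _);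
  exact: val_inj.
Qed.

Lemma ord3_eqE : (((0 : 'I_3) == 1) = false) * (((0 : 'I_3) == 2) = false) *
  (((1 : 'I_3) == 0) = false) * (((1 : 'I_3) == 2) = false) *
  (((2 : 'I_3) == 0) = false) * (((2 : 'I_3) == 1) = false).
Proof. by do ![split]. Qed.

Lemma frame_fieldE C p k : frame_field C p 0 k = zc p * C k p.
Proof.
rewrite summxE (bigD1 k) //= big1 ?addr0 => [|j jk].
  by rewrite !mxE !eqxx mulr1 mulrC.
by rewrite !mxE eqxx eq_sym (negbTE jk) !mulr0.
Qed.

Lemma frame_field_xi i : frame_field (fun k _ => (k == i)%:R) = xi i.
Proof.
apply/funext => p; apply/rowP => k; rewrite frame_fieldE !mxE eqxx //.
Qed.

Lemma derive_metric i j l p : 0 < zc p ->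
  'D_(evec i) (fun q => metric q j l) p =
  - 2 * (zc p ^+ 3)^-1 * (i == 2)%:R * (j == l)%:R.
Proof.
move=> z0; have zn : zc p != 0 by exact: lt0r_neq0.
have -> : (fun q : point => metric q j l) =
    (fun q => (q 0 2 ^+ 2)^-1 * (j == l)%:R).
  by apply/funext => q; rewrite mxE mulr_natr.
apply: derive_of.
  apply: is_derive_mul; apply: is_derive_inv; first exact: expf_neq0.
  exact/is_derive_sqr/is_derive_coord.
by rewrite /= evecE -/(zc p) (eq_sym 2); field; exact: zn.
Qed.

Lemma christoffelE k i j p : 0 < zc p -> christoffel k i j p =
  (zc p)^-1 * ((k == 2)%:R * (i == j)%:R - (i == 2)%:R * (j == k)%:R
               - (j == 2)%:R * (i == k)%:R).
Proof.
move=> z0; have zn : zc p != 0 by exact: lt0r_neq0.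
have im : invmx (metric p) = (zc p ^+ 2)%:M by rewrite invmx_scalar invrK.
rewrite /christoffel im (bigD1 k) //= big1 ?addr0 => [|l lk]; last first.
  by rewrite mxE eq_sym (negbTE lk) mul0r.
rewrite mxE eqxx mulr1n !derive_metric //.
by field; exact: zn.
Qed.

Lemma derive_frame_field C p v : (forall k, differentiable (C k) p) ->
  derivable (frame_field C) p v /\ 'D_v (frame_field C) p =
  \row_k (zc p * 'D_v (C k) p + C k p * v 0 2).
Proof.
move=> dC.
have dk k : is_derive p v (fun q => frame_field C q 0 k)
    (zc p * 'D_v (C k) p + C k p * v 0 2).
  have -> : (fun q => frame_field C q 0 k) = (fun q => q 0 2 * C k q).
    by apply/funext => q; rewrite frame_fieldE.
  by apply: is_derive_mul; [exact: is_derive_coord|exact: is_derive_diff].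
have df : derivable (frame_field C) p v.
  by apply/derivable_mxP => i k; rewrite (ord1 i); apply: ex_derive.
split=> //; rewrite derive_mx //; apply/rowP => k; rewrite !mxE.
exact: derive_val.
Qed.

(** In the frame [xi] the Christoffel symbols combine with the derivative of the
    factor [z] of [xi k] into constants. *)
Lemma covD_frame C (Y : point -> point) i p : 0 < zc p ->
  (forall k, differentiable (C k) p) ->
  (\forall q \near p, Y q = frame_field C q) ->
  covD (xi i) Y p = frame_field (frame_covD i C) p.
Proof.
move=> z0 dC YC; have zn : zc p != 0 by exact: lt0r_neq0.
have [_ dY] := derive_frame_field (xi i p) dC.
rewrite /covD (near_eq_derive _ YC) dY (nbhs_singleton YC).
apply/rowP => k; rewrite frame_fieldE !mxE /frame_covD.
have -> : 'D_(xi i p) (C k) p = zc p * partial i (C k) p.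
  by rewrite /partial !deriveE // linearZ.
rewrite !sum3E !christoffelE // !frame_fieldE !mxE !eqxx.
clear dY YC dC; move: k i; apply: ord3P; apply: ord3P; rewrite ?ord3_eqE ?eqxx.
all: move: (@partial R) (C 0) (C 1) (C 2) => P c0 c1 c2.
all: by rewrite /= ?mulr1n ?mulr0n; field; exact: zn.
Qed.

End Geometry.

Ltac differentiate := repeat first
  [ exact: is_derive_const | exact: is_derive_coord | eapply is_derive_opp
  | eapply is_derive_add | eapply is_derive_sqr | eapply is_derive_mul
  | by apply: is_derive_diff ].

(** * The harmonic equation in components *)

Section Harmonic.
Context {R : realType}.
Notation point := 'rV[R]_3.
Variables (M : set point) (MH3 : M `<=` H3) (openM : open M).
Implicit Types (p : point) (C : 'I_3 -> point -> R).

Lemma smooth_frame_covD i C k : (forall j, smooth_on M (C j)) ->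
  smooth_on M (frame_covD i C k).
Proof.
move=> sC; apply: smoothD => //; first apply: smoothD => //.
- by apply: smoothM => //; [exact: smooth_coord|exact: smooth_partial].
- by apply: smoothM => //; exact: smooth_cst.
- by apply: smoothN => //; apply: smoothM => //; exact: smooth_cst.
Qed.

Lemma partial_frame_covD j i C k p : M p -> (forall j, smooth_on M (C j)) ->
  partial j (frame_covD i C k) p =
  zc p * partial j (partial i (C k)) p + (j == 2)%:R * partial i (C k) p
  + (k == 2)%:R * partial j (C i) p - (k == i)%:R * partial j (C 2) p.
Proof.
move=> Mp sC; have dC l : differentiable (C l) p := smooth_diff (sC l) Mp.
have ddC : differentiable (partial i (C k)) p.
  exact/(smooth_diff _ Mp)/smooth_partial.
apply: partial_of; first by differentiate.
rewrite /= evecE (eq_sym 2) -/(zc p) -!/(partial _ _ _).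
by move: (@partial R) (zc p) => P z; ring.
Qed.

Lemma covD_ext (X X' Y : point -> point) p : X p = X' p ->
  covD X Y p = covD X' Y p.
Proof. by move=> e; rewrite /covD e. Qed.

Lemma covD0 (X Y : point -> point) p : X p = 0 -> covD X Y p = 0.
Proof.
move=> e; rewrite /covD e derive0 add0r; apply/rowP => k; rewrite !mxE.
by rewrite big1 // => i _; rewrite big1 // => j _; rewrite mxE mulr0 mul0r.
Qed.

Lemma covD_xi_xi i p : 0 < zc p ->
  covD (xi i) (xi i) p = (i != 2)%:R *: xi 2 p.
Proof.
move=> z0; rewrite (@covD_frame _ (fun k _ => (k == i)%:R)) //; first last.
- by near=> q; rewrite frame_field_xi.
apply/rowP => k; rewrite frame_fieldE /frame_covD partial_cst mulr0 add0r !mxE.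
by move: k i; apply: ord3P; apply: ord3P; rewrite ?ord3_eqE ?eqxx /=; ring.
Unshelve. all: by end_near. Qed.

(** The correction term is [nabla_{nabla_{xi i} xi i} sigma], which is
    [nabla_{xi 2} sigma] for the horizontal [xi i] and zero for [xi 2]. *)
Lemma covD2_frame (sigma : point -> point) C i p :
  M p -> (forall j, smooth_on M (C j)) ->
  (forall q, M q -> sigma q = frame_field C q) ->
  covD2 (xi i) (xi i) sigma p = frame_field (fun k q =>
    frame_covD i (frame_covD i C) k q - (i != 2)%:R * frame_covD 2 C k q) p.
Proof.
move=> Mp sC sE; have z0 := MH3 Mp.
have cD j q : M q -> covD (xi j) sigma q = frame_field (frame_covD j C) q.
  move=> Mq; apply: covD_frame; first exact: MH3.
    by move=> k; exact: smooth_diff (sC k) Mq.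
  exact: open_near sE.
rewrite /covD2 (@covD_frame _ (frame_covD i C)) //; first last.
- by apply: (open_near openM Mp) => q; exact: cD.
- by move=> k; apply: smooth_diff Mp; exact: smooth_frame_covD.
have -> : covD (covD (xi i) (xi i)) sigma p =
    (i != 2)%:R *: frame_field (frame_covD 2 C) p.
  have [i2|i2] := eqVneq i 2.
    by rewrite scale0r covD0 // covD_xi_xi // i2 eqxx scale0r.
  rewrite scale1r -cD //; apply: covD_ext.
  by rewrite covD_xi_xi // i2 scale1r.
by apply/rowP => k; rewrite !mxE !frame_fieldE; ring.
Qed.

Lemma inner_frame C D p : 0 < zc p ->
  inner p (frame_field C p) (frame_field D p) = \sum_k C k p * D k p.
Proof.
move=> z0; have zn : zc p != 0 by exact: lt0r_neq0.
rewrite /inner /metric mul_mx_scalar -scalemxAl !mxE.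
rewrite mulr_sumr; apply: eq_bigr => k _.
by rewrite mxE !frame_fieldE; field; exact: zn.
Qed.

(** Twice the energy density of the map [(c, s)] for the Euclidean metric. *)
Definition sq_gradients (c s : point -> R) p :=
  \sum_i (partial i c p ^+ 2 + partial i s p ^+ 2).

(** The squared norm of [nabla sigma] is [z^2] times [sq_gradients], plus one.
    The constant one comes from the rotation of [xi 0] and [xi 1] into [xi 2];
    the zero order term of the rough Laplacian matches it, so it drops out. *)
Lemma harmonic_system (sigma : point -> point) C p :
  M p -> (forall j, smooth_on M (C j)) -> C 2 = (fun=> 0) ->
  (forall q, M q -> sigma q = frame_field C q) ->
  C 0 p ^+ 2 + C 1 p ^+ 2 = 1 ->
  rough_laplacian sigma p = covD_norm2 sigma p *: sigma p ->
  [/\ zc p * \sum_i partial i (partial i (C 0)) p - partial 2 (C 0) p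
        = - (zc p * sq_gradients (C 0) (C 1) p * C 0 p),
      zc p * \sum_i partial i (partial i (C 1)) p - partial 2 (C 1) p
        = - (zc p * sq_gradients (C 0) (C 1) p * C 1 p) &
      partial 0 (C 0) p + partial 1 (C 1) p = 0].
Proof.
move=> Mp sC C2 sE cs1 harm; have z0 := MH3 Mp.
have zn : zc p != 0 by exact: lt0r_neq0.
have dC2 i : partial i (C 2) p = 0 by rewrite C2 partial_cst.
have ddC2 i j : partial i (partial j (C 2)) p = 0.
  rewrite (_ : partial j _ = fun=> 0) ?partial_cst //.
  by apply/funext => q; rewrite C2 partial_cst.
have C2p : C 2 p = 0 by rewrite C2.
have nE : covD_norm2 sigma p = zc p ^+ 2 * sq_gradients (C 0) (C 1) p + 1.
  rewrite /covD_norm2 /sq_gradients -cs1 !sum3E.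
  have cD j : covD (xi j) sigma p = frame_field (frame_covD j C) p.
    apply: covD_frame => //; last exact: open_near sE.
    by move=> k; exact: smooth_diff (sC k) Mp.
  rewrite !cD !inner_frame // !sum3E /frame_covD !dC2 ?ord3_eqE ?eqxx C2p /=.
  by move: (@partial R) (zc p) => P z; ring.
have main k : - \sum_i (frame_covD i (frame_covD i C) k p
      - (i != 2)%:R * frame_covD 2 C k p) =
   (zc p ^+ 2 * sq_gradients (C 0) (C 1) p + 1) * C k p.
  apply: (mulfI zn); rewrite mulrCA -frame_fieldE -sE // -nE.
  have := congr1 (fun v : point => v 0 k) harm; rewrite !mxE => <-.
  rewrite mulrN mulr_sumr summxE; congr (- _); apply: eq_bigr => i _.
  by rewrite (covD2_frame _ Mp sC sE) frame_fieldE.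
have := main 0; have := main 1; have := main 2; clear main nE harm sE.
rewrite !sum3E /frame_covD -/(frame_covD _ _) !partial_frame_covD //.
rewrite !dC2 !ddC2 C2p ?ord3_eqE ?eqxx /=.
move: (sq_gradients _ _ p) zn => N; move: (C 0) (C 1) => c s; clear.
rewrite ?mulr1n ?mulr0n; move: (@partial R) (zc p) => P z zn e2 e1 e0.
by split; apply: (mulfI zn); lra.
Qed.

End Harmonic.

(** * Horospherical harmonic fields as pairs of functions *)

Section Classification.
Context {R : realType}.
Notation point := 'rV[R]_3.
Implicit Types (p v : point).

Definition harmonic_components (M : set point) (sigma : point -> point)
    (c s : point -> R) :=
  [/\ smooth_on M c, smooth_on M s,
      forall p, M p -> sigma p = c p *: xi 0 p + s p *: xi 1 p,
      forall p, M p -> c p ^+ 2 + s p ^+ 2 = 1 &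
      forall p, M p ->
      [/\ zc p * \sum_i partial i (partial i c) p - partial 2 c p
            = - (zc p * sq_gradients c s p * c p),
          zc p * \sum_i partial i (partial i s) p - partial 2 s p
            = - (zc p * sq_gradients c s p * s p) &
          partial 0 c p + partial 1 s p = 0]].

(** Dividing the coordinates of [sigma] by [z] gives the coefficients in the
    frame; their smoothness is inherited from [sigma], without any choice of an
    angle function. *)
Lemma harmonic_componentsP (M : set point) (sigma : point -> point) :
  M `<=` H3 -> open M -> horospherical M sigma -> harmonic_unit_field M sigma ->
  exists c s, harmonic_components M sigma c s.
Proof.
move=> MH3 oM [uf tang] [ssig _ harm].
pose C (k : 'I_3) p : R := if k == 2 then 0 else sigma p 0 k * (zc p)^-1.
have zn p : M p -> zc p != 0 by move=> /MH3 z0; exact: lt0r_neq0.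
have C2 : C 2 = (fun=> 0) by apply/funext.
have sC k : smooth_on M (C k).
  have [k2|k2] := eqVneq k 2; first by rewrite k2 C2; exact: smooth_cst.
  have -> : C k = fun p => sigma p 0 k * (zc p)^-1.
    by apply/funext => p; rewrite /C (negbTE k2).
  apply: smoothM => //; first exact: smooth_entry.
  by apply: smoothV => //; exact: smooth_coord.
have sE p : M p -> sigma p = frame_field C p.
  move=> Mp; apply/rowP => k; rewrite frame_fieldE /C.
  have [->|_] := eqVneq k 2; first by rewrite mulr0; exact: tang.
  by rewrite mulrCA mulfV ?mulr1 // zn.
have cs1 p : M p -> C 0 p ^+ 2 + C 1 p ^+ 2 = 1.
  move=> Mp; have := uf p Mp; rewrite sE // inner_frame; last exact: MH3.
  by rewrite sum3E C2 mulr0 addr0.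
exists (C 0), (C 1); split=> // p Mp.
  by rewrite sE // /frame_field sum3E C2 scale0r addr0.
by apply: (harmonic_system MH3 oM Mp sC C2 sE (cs1 p Mp)); exact: harm.
Qed.

Lemma frame_coordinates (a b a' b' : R) p : 0 < zc p ->
  a *: xi 0 p + b *: xi 1 p = a' *: xi 0 p + b' *: xi 1 p -> a = a' /\ b = b'.
Proof.
move=> z0 /rowP e; have zn : zc p != 0 by exact: lt0r_neq0.
split; apply: (mulIf zn).
  by have := e 0; rewrite !mxE !eqxx ?ord3_eqE /= !mulr1 !mulr0 !addr0.
by have := e 1; rewrite !mxE !eqxx ?ord3_eqE /= !mulr1 !mulr0 !add0r.
Qed.

Lemma partial_translation_invariant (U : set point) (f : point -> R) i p :
  open U -> U p ->
  (forall h : R, U (h *: evec i + p) -> f (h *: evec i + p) = f p) ->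
  partial i f p = 0.
Proof.
move=> oU Up fU; apply: partial_of (erefl 0); apply: is_derive_line0.
have cont : {for (0 : R), continuous (fun h : R => h *: (evec i : point) + p)}.
  by apply: continuousD; [exact: scalel_continuous|exact: cst_continuous].
have nU : \forall h \near (0 : R), U (h *: evec i + p).
  by apply: cont; rewrite scale0r add0r; exact: open_nbhs_nbhs.
apply: (@near_eq_is_derive _ _ _ (fun=> f p)).
by apply: filterS nU => h Uh; rewrite fU.
Qed.

Section Components.
Variables (M : set point) (sigma : point -> point) (c s : point -> R).
Hypotheses (MH3 : M `<=` H3) (oM : open M) (cM : connected M).
Hypothesis hc : harmonic_components M sigma c s.

Let sc : smooth_on M c. Proof. by case: hc. Qed.
Let ss : smooth_on M s. Proof. by case: hc. Qed.
Let cs1 p : M p -> c p ^+ 2 + s p ^+ 2 = 1.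
Proof. by case: hc => _ _ _ + _; apply. Qed.
Let zn p : M p -> zc p != 0.
Proof. by move=> /MH3 z0; exact: lt0r_neq0. Qed.

(** The derivative of a unit vector is orthogonal to it. *)
Lemma partials_orthogonal i p : M p ->
  c p * partial i c p + s p * partial i s p = 0.
Proof.
move=> Mp; have dc := smooth_diff sc Mp; have ds := smooth_diff ss Mp.
have := partial_eq i oM Mp cs1; rewrite partial_cst => e.
have : partial i (fun q => c q ^+ 2 + s q ^+ 2) p =
    2 * c p * partial i c p + 2 * s p * partial i s p.
  by apply: partial_of (erefl _); differentiate.
rewrite e; move: (@partial R) => P; lra.
Qed.

Lemma locally_angle_components (Q : set point -> (point -> R) -> Prop) p :
  M p -> locally_angle Q M sigma ->
  exists (U : set point) (u : point -> R), [/\ open U, U p, U `<=` M, Q U u &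
    forall q, U q -> c q = cos (u q) /\ s q = sin (u q)].
Proof.
move=> Mp /(_ p Mp) [U [u [oU Up UM [_ sE] QU]]]; exists U, u; split=> // q Uq.
apply: (@frame_coordinates _ _ _ _ q); first exact/MH3/UM.
by case: hc => _ _ E _ _; rewrite -sE // E //; exact: UM.
Qed.

(** An angle function is only available on a small neighbourhood, but the
    vanishing of a partial derivative is a local matter. *)
Lemma partial_angle0 i (Q : set point -> (point -> R) -> Prop) :
  (forall U u p (h : R), Q U u -> U p -> U (h *: evec i + p) ->
     u (h *: evec i + p) = u p) ->
  locally_angle Q M sigma ->
  forall p, M p -> partial i c p = 0 /\ partial i s p = 0.
Proof.
move=> Qi la p Mp.
have [U [u [oU Up UM QU csE]]] := locally_angle_components Mp la.
by split; apply: (@partial_translation_invariant U) => // h Uh;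
  have [e1 e2] := csE _ Uh; have [e3 e4] := csE _ Up; rewrite (e1, e2) (e3, e4);
  congr (_ _); apply: Qi QU Up Uh.
Qed.

Lemma constant_components : (forall i p, M p -> partial i c p = 0) ->
  (forall i p, M p -> partial i s p = 0) -> invariant_field M sigma.
Proof.
move=> c0 s0; have [[p0 Mp0]|M0] := pselect (M !=set0); last first.
  by exists 0, 0 => p Mp; case: M0; exists p.
exists (c p0), (s p0) => p Mp; case: hc => _ _ -> // _ _.
rewrite (@partials0_constant _ M c cM oM _ c0 _ _ Mp Mp0); last first.
  by move=> q Mq; exact: smooth_diff Mq.
rewrite (@partials0_constant _ M s cM oM _ s0 _ _ Mp Mp0) //.
by move=> q Mq; exact: smooth_diff Mq.
Qed.

(** * Fields independent of the height *)

Section PlaneCase.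
Hypotheses (cz0 : forall p, M p -> partial 2 c p = 0)
  (sz0 : forall p, M p -> partial 2 s p = 0).

(** For a divergence free planar unit field this is also the signed curvature of
    the integral curves. *)
Definition curl p : R := partial 0 s p - partial 1 c p.

(** Unit length leaves one degree of freedom for each of the two partial
    derivatives of [(c, s)], and the divergence equation relates the two: the
    gradient of the angle is [curl] times [(c, s)]. *)
Lemma partials_of_curl p : M p ->
  [/\ partial 0 c p = - curl p * c p * s p, partial 1 c p = - curl p * s p ^+ 2,
      partial 0 s p = curl p * c p ^+ 2 & partial 1 s p = curl p * c p * s p].
Proof.
move=> Mp; have := cs1 Mp.
have := partials_orthogonal 0 Mp; have := partials_orthogonal 1 Mp.
have [_ _ _ _ /(_ p Mp) [_ _]] := hc.
rewrite /curl.
move: (partial 0 c p) (partial 1 c p) (partial 0 s p) (partial 1 s p).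
move: (c p) (s p) => C S a b a' b' div e1 e0 u.
(* [div] leaves [a], [b], [a'] as unknowns; each is expanded with
   [C^2 + S^2 = 1] and reduced by the two orthogonality relations *)
have E : b' = - a by lra.
rewrite E in div e1 *; clear E.
split.
- transitivity (a * (C ^+ 2 + S ^+ 2)); first by rewrite u mulr1.
  have -> : a * (C ^+ 2 + S ^+ 2) =
    C * (C * a + S * a') - S * (C * b + S * - a) - (a' - b) * C * S by ring.
  by rewrite e0 e1; ring.
- transitivity (b * (C ^+ 2 + S ^+ 2)); first by rewrite u mulr1.
  have -> : b * (C ^+ 2 + S ^+ 2) =
    C * (C * b + S * - a) + S * (C * a + S * a') - S ^+ 2 * (a' - b) by ring.
  by rewrite e0 e1; ring.
- transitivity (a' * (C ^+ 2 + S ^+ 2)); first by rewrite u mulr1.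
  have -> : a' * (C ^+ 2 + S ^+ 2) =
    C * (C * b + S * - a) + S * (C * a + S * a') + C ^+ 2 * (a' - b) by ring.
  by rewrite e0 e1; ring.
- transitivity (- a * (C ^+ 2 + S ^+ 2)); first by rewrite u mulr1.
  have -> : - a * (C ^+ 2 + S ^+ 2) =
    S * (C * b + S * - a) - C * (C * a + S * a') + (a' - b) * C * S by ring.
  by rewrite e0 e1; ring.
Qed.

Lemma sq_gradients_curl p : M p -> sq_gradients c s p = curl p ^+ 2.
Proof.
move=> Mp; have [a b a' b'] := partials_of_curl Mp.
rewrite /sq_gradients sum3E cz0 // sz0 // a b a' b'; have := cs1 Mp.
move: (c p) (s p) (curl p) => C S l u.
transitivity (l ^+ 2 * (C ^+ 2 + S ^+ 2) ^+ 2); last by rewrite u expr1n mulr1.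
by ring.
Qed.

Lemma laplacian_components p : M p ->
  partial 0 (partial 0 c) p + partial 1 (partial 1 c) p = - curl p ^+ 2 * c p /\
  partial 0 (partial 0 s) p + partial 1 (partial 1 s) p = - curl p ^+ 2 * s p.
Proof.
move=> Mp; have [_ _ _ _ /(_ p Mp) [ec es _]] := hc.
have c22 : partial 2 (partial 2 c) p = 0.
  by rewrite (partial_eq 2 oM Mp cz0) partial_cst.
have s22 : partial 2 (partial 2 s) p = 0.
  by rewrite (partial_eq 2 oM Mp sz0) partial_cst.
rewrite sq_gradients_curl // sum3E c22 cz0 // in ec.
rewrite sq_gradients_curl // sum3E s22 sz0 // in es.
rewrite addr0 subr0 in ec; rewrite addr0 subr0 in es.
by split; apply: (mulfI (zn Mp)); [rewrite ec|rewrite es]; ring.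
Qed.

(** The gradient of [curl] is [curl^2 N], with [N = (-s, c)]: exchanging the
    order of differentiation and using the divergence equation turns the partial
    derivatives of [curl] into plane Laplacians of [s] and [- c]. *)
Lemma partial_curl i p : M p ->
  partial i curl p = ((i == 1)%:R * c p - (i == 0)%:R * s p) * curl p * curl p.
Proof.
move=> Mp; have dsx := smooth_diff (smooth_partial 0 ss) Mp.
have dcy := smooth_diff (smooth_partial 1 sc) Mp.
have -> : partial i curl p =
    partial i (partial 0 s) p - partial i (partial 1 c) p.
  by apply: partial_of (erefl _); rewrite /curl; differentiate.
have [lc ls] := laplacian_components Mp.
have div q : M q -> partial 0 c q = - partial 1 s q.
  move=> Mq; apply/eqP; rewrite -addr_eq0.
  by case: hc => _ _ _ _ /(_ q Mq) [_ _ ->].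
have ddiv j : partial j (partial 0 c) p = - partial j (partial 1 s) p.
  rewrite (partial_eq j oM Mp div).
  have d1s := smooth_diff (smooth_partial 1 ss) Mp.
  by apply: partial_of (erefl _); differentiate.
move: i; apply: ord3P; rewrite ?ord3_eqE ?eqxx /=.
- by rewrite (mixed_partials 0 1 oM sc Mp) ddiv opprK ls; ring.
- rewrite (mixed_partials 1 0 oM ss Mp).
  apply: etrans (congr1 (+%R^~ _) (esym (canLR opprK (ddiv 0)))) _.
  by rewrite -opprD lc; ring.
- rewrite (mixed_partials 2 0 oM ss Mp) (mixed_partials 2 1 oM sc Mp).
  rewrite (partial_eq 0 oM Mp sz0) (partial_eq 1 oM Mp cz0) !partial_cst.
  by ring.
Qed.

(** Homogeneous coordinates [(l : - s + l x : c + l y)] of the centre of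
    curvature [P + N / l] of the integral curve through [P], where [l] is the
    curl.  They make sense also for [l = 0], where the centre is at infinity. *)
Definition homogeneous_centre (j : 'I_3) p : R :=
  if j == 0 then curl p else if j == 1 then - s p + curl p * xc p
  else c p + curl p * yc p.

(** All integral curves have the same centre of curvature. *)
Lemma homogeneous_centre_proportional :
  exists (n : point -> R) (k : 'I_3 -> R),
    forall p, M p -> 0 < n p /\ forall j, homogeneous_centre j p = n p * k j.
Proof.
have slam : smooth_on M curl.
  by apply: smoothD => //; [|apply: smoothN => //]; exact: smooth_partial.
apply: common_rate_proportional => // [p v Mp|p Mp].
  have dlam := smooth_diff slam Mp.
  have ds := smooth_diff ss Mp; have dc := smooth_diff sc Mp.
  have ec : 'D_v c p = - s p * curl p * (c p * v 0 0 + s p * v 0 1).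
    have [a b a' b'] := partials_of_curl Mp.
    by rewrite derive_partials // sum3E a b cz0 //; ring.
  have es : 'D_v s p = c p * curl p * (c p * v 0 0 + s p * v 0 1).
    have [a b a' b'] := partials_of_curl Mp.
    by rewrite derive_partials // sum3E a' b' sz0 //; ring.
  have el : 'D_v curl p = (c p * v 0 1 - s p * v 0 0) * curl p * curl p.
    rewrite derive_partials // sum3E !partial_curl // ?ord3_eqE ?eqxx /=.
    by ring.
  have dl : is_derive p v curl ((c p * v 0 1 - s p * v 0 0) * curl p * curl p).
    by rewrite -el; exact: is_derive_diff.
  have dcv : is_derive p v c (- s p * curl p * (c p * v 0 0 + s p * v 0 1)).
    by rewrite -ec; exact: is_derive_diff.
  have dsv : is_derive p v s (c p * curl p * (c p * v 0 0 + s p * v 0 1)).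
    by rewrite -es; exact: is_derive_diff.
  (* the common rate is the product of [curl] and the component of [v] on [N] *)
  exists ((c p * v 0 1 - s p * v 0 0) * curl p); apply: ord3P.
  - exact: dl.
  - apply: is_derive_eq (is_derive_add (is_derive_opp dsv)
      (is_derive_mul dl (is_derive_coord p v 0))) _.
    rewrite /homogeneous_centre /= /xc; have := cs1 Mp.
    move: (c p) (s p) (curl p) (p 0 0) (v 0 0) (v 0 1) => C S l x a b u.
    have -> : l * a = l * a * (C ^+ 2 + S ^+ 2) by rewrite u mulr1.
    by ring.
  - apply: is_derive_eq (is_derive_add dcv
      (is_derive_mul dl (is_derive_coord p v 1))) _.
    rewrite /homogeneous_centre /= /yc; have := cs1 Mp.
    move: (c p) (s p) (curl p) (p 0 1) (v 0 0) (v 0 1) => C S l x a b u.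
    have -> : l * b = l * b * (C ^+ 2 + S ^+ 2) by rewrite u mulr1.
    by ring.
have [l0|l0] := eqVneq (curl p) 0; last by exists 0.
have [c0|c0] := eqVneq (c p) 0; last first.
  by exists 2; rewrite /homogeneous_centre /= l0 mul0r addr0.
exists 1; rewrite /homogeneous_centre /= l0 mul0r addr0 oppr_eq0.
apply/eqP => s0; have := cs1 Mp; rewrite c0 s0 expr0n /= addr0 => /eqP.
by rewrite eq_sym oner_eq0.
Qed.

(** The field is orthogonal to the radius vector from [(a, b)], and its length
    one forces [|l|] to be the inverse of the distance to [(a, b)]. *)
Lemma translate_theta (a b l : R) p : M p ->
  s p = l * (xc p - a) -> c p = - l * (yc p - b) ->
  sigma p = Num.sg l *: translate_field a b theta_hat p.
Proof.
move=> Mp es ec; set X := xc p - a in es; set Y := yc p - b in ec.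
pose q := translation (- a) (- b) p.
have xq : xc q = X.
  by rewrite /q /translation /X /xc !mxE !eqxx ?ord3_eqE /=; ring.
have yq : yc q = Y.
  by rewrite /q /translation /Y /yc !mxE !eqxx ?ord3_eqE /=; ring.
have xiq i : xi i q = xi i p.
  rewrite /xi; congr (_ *: _).
  by rewrite /q /translation /zc !mxE !ord3_eqE /=; ring.
have r1 : `|l| * Num.sqrt (X ^+ 2 + Y ^+ 2) = 1.
  rewrite -sqrtr_sqr -sqrtrM ?sqr_ge0 // -[RHS]sqrtr1 -(cs1 Mp) es ec.
  by congr Num.sqrt; ring.
have r0 : Num.sqrt (X ^+ 2 + Y ^+ 2) != 0.
  by apply: contra_eq_neq r1 => ->; rewrite mulr0 eq_sym oner_eq0.
have lE : l = Num.sg l / Num.sqrt (X ^+ 2 + Y ^+ 2).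
  by apply: (mulIf r0); rewrite divfK // {1}[l]numEsg -mulrA r1 mulr1.
have [_ _ -> // _ _] := hc.
rewrite /translate_field -/q /theta_hat xq yq !xiq scalerDr !scalerA ec es.
by congr (_ *: _ + _ *: _); rewrite {1}lE; ring.
Qed.

(** The first homogeneous coordinate of the common centre decides between a
    centre at infinity, where the field is constant, and a finite one; in the
    latter case its sign is that of [curl] and fixes the sense of rotation. *)
Theorem plane_case : [\/ invariant_field M sigma,
   translate_of theta_hat M sigma |
   translate_of (fun p => - theta_hat p) M sigma].
Proof.
have [n [k nk]] := homogeneous_centre_proportional.
have lam p : M p -> curl p = n p * k 0.
  by move=> /nk [_ /(_ 0)].
have [k0|k0] := eqVneq (k 0) 0.
  constructor 1; have l0 p : M p -> curl p = 0.
    by move=> Mp; rewrite lam // k0 mulr0.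
  apply: constant_components => i p Mp;
    have [a b a' b'] := partials_of_curl Mp;
    move: i; apply: ord3P; rewrite ?a ?b ?a' ?b' ?l0 ?cz0 ?sz0 //; ring.
pose a := k 1 / k 0; pose b := k 2 / k 0.
have es p : M p -> s p = curl p * (xc p - a).
  move=> Mp; have [_ /(_ 1)] := nk p Mp.
  rewrite /homogeneous_centre /= lam // => e.
  transitivity (n p * k 0 * xc p - n p * k 1); first by rewrite -e; ring.
  by rewrite /a; field.
have ec p : M p -> c p = - curl p * (yc p - b).
  move=> Mp; have [_ /(_ 2)] := nk p Mp.
  rewrite /homogeneous_centre /= lam // => e.
  transitivity (n p * k 2 - n p * k 0 * yc p); first by rewrite -e; ring.
  by rewrite /b; field.
have off : M `<=` ~` (translation a b @` zaxis).
  move=> p Mp [q [qx qy] qp]; have := cs1 Mp; rewrite es // ec //.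
  have -> : xc p = a.
    by rewrite -qp /translation /xc !mxE -/(xc q) qx !eqxx ?ord3_eqE /=; ring.
  have -> : yc p = b.
    by rewrite -qp /translation /yc !mxE -/(yc q) qy !eqxx ?ord3_eqE /=; ring.
  by rewrite !subrr !mulr0 expr0n /= addr0 => /eqP; rewrite eq_sym oner_eq0.
have sgl p : M p -> Num.sg (curl p) = Num.sg (k 0).
  by move=> Mp; rewrite lam // sgrM gtr0_sg ?mul1r //; case: (nk p Mp).
have [kp|kn|k00] := ltrgt0P (k 0).
- constructor 2; exists a, b; split=> // p Mp.
  by rewrite (translate_theta Mp (es p Mp) (ec p Mp)) sgl // gtr0_sg // scale1r.
- constructor 3; exists a, b; split=> // p Mp.
  rewrite (translate_theta Mp (es p Mp) (ec p Mp)) sgl //.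
  by rewrite ltr0_sg // scaleN1r.
- by rewrite k00 eqxx in k0.
Qed.

End PlaneCase.
(** * Fields depending only on the height *)

Section VerticalCase.
Hypotheses (cx0 : forall p, M p -> partial 0 c p = 0)
  (cy0 : forall p, M p -> partial 1 c p = 0)
  (sx0 : forall p, M p -> partial 0 s p = 0)
  (sy0 : forall p, M p -> partial 1 s p = 0).

(** The derivative of the angle with respect to [z]. *)
Definition twist p : R := c p * partial 2 s p - s p * partial 2 c p.

Lemma partials_of_twist p : M p ->
  partial 2 c p = - s p * twist p /\ partial 2 s p = c p * twist p.
Proof.
move=> Mp; have := cs1 Mp; have := partials_orthogonal 2 Mp.
rewrite /twist; move: (partial 2 c p) (partial 2 s p) (c p) (s p).
move=> a b C S e u; split.
- transitivity (a * (C ^+ 2 + S ^+ 2)); first by rewrite u mulr1.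
  have -> : a * (C ^+ 2 + S ^+ 2) =
    C * (C * a + S * b) - S * (C * b - S * a) by ring.
  by rewrite e; ring.
- transitivity (b * (C ^+ 2 + S ^+ 2)); first by rewrite u mulr1.
  have -> : b * (C ^+ 2 + S ^+ 2) =
    S * (C * a + S * b) + C * (C * b - S * a) by ring.
  by rewrite e; ring.
Qed.

(** In the combination [c s_zz - s c_zz] the energy terms of the two harmonic
    map equations cancel, which leaves the linear equation
    [twist_z = twist / z]. *)
Lemma partial_twist i p : M p ->
  partial i twist p = (i == 2)%:R * (twist p * (zc p)^-1).
Proof.
move=> Mp; have ds := smooth_diff ss Mp; have dc := smooth_diff sc Mp.
have dsz := smooth_diff (smooth_partial 2 ss) Mp.
have dcz := smooth_diff (smooth_partial 2 sc) Mp.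
have -> : partial i twist p =
    c p * partial i (partial 2 s) p + partial 2 s p * partial i c p
    - (s p * partial i (partial 2 c) p + partial 2 c p * partial i s p).
  by apply: partial_of (erefl _); rewrite /twist; differentiate.
move: i; apply: ord3P; rewrite ?ord3_eqE ?eqxx /= ?mulr0n ?mulr1n ?mul0r ?mul1r.
- rewrite (mixed_partials 0 2 oM ss Mp) (mixed_partials 0 2 oM sc Mp).
  rewrite (partial_eq 2 oM Mp sx0) (partial_eq 2 oM Mp cx0) !partial_cst.
  by rewrite sx0 // cx0 // !mulr0 !addr0 subr0.
- rewrite (mixed_partials 1 2 oM ss Mp) (mixed_partials 1 2 oM sc Mp).
  rewrite (partial_eq 2 oM Mp sy0) (partial_eq 2 oM Mp cy0) !partial_cst.
  by rewrite sy0 // cy0 // !mulr0 !addr0 subr0.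
have [_ _ _ _ /(_ p Mp) [ec es _]] := hc; move: ec es.
have sumE f : (forall q, M q -> partial 0 f q = 0) ->
    (forall q, M q -> partial 1 f q = 0) ->
    \sum_i partial i (partial i f) p = partial 2 (partial 2 f) p.
  move=> f0 f1; rewrite sum3E.
  have -> := partial_eq 0 oM Mp f0; have -> := partial_eq 1 oM Mp f1.
  by rewrite !partial_cst !add0r.
rewrite (sumE _ cx0 cy0) (sumE _ sx0 sy0) {sumE}.
rewrite /twist; have := zn Mp.
move: (sq_gradients c s p).
move: (partial 2 (partial 2 c) p) (partial 2 (partial 2 s) p).
move: (partial 2 c p) (partial 2 s p) (c p) (s p) (zc p).
move=> a b C S z a2 b2 N z0 ec es.
apply: (mulfI z0); rewrite mulrCA mulfV // mulr1.
transitivity (C * (z * b2 - b) - S * (z * a2 - a) + (C * b - S * a)).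
  by ring.
by rewrite ec es; ring.
Qed.

Lemma twist_proportional : exists k : R, forall p, M p -> twist p = k * zc p.
Proof.
have [[p0 Mp0]|M0] := pselect (M !=set0); last first.
  by exists 0 => p Mp; case: M0; exists p.
have stw : smooth_on M twist.
  apply: smoothD => //; [|apply: smoothN => //];
    by apply: smoothM => //; exact: smooth_partial.
exists (twist p0 / zc p0) => p Mp; pose g q := twist q * (zc q)^-1.
suff -> : twist p0 / zc p0 = g p by rewrite divfK // zn.
apply: (gradient0_constant cM oM) => // q v Mq.
have dt : is_derive q v twist (v 0 2 * (twist q * (zc q)^-1)).
  have d := smooth_diff stw Mq.
  suff <- : 'D_v twist q = v 0 2 * (twist q * (zc q)^-1).
    exact: is_derive_diff.
  rewrite derive_partials // sum3E !partial_twist // ?ord3_eqE ?eqxx /=.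
  by ring.
apply: (is_derive_eq (is_derive_mul dt
  (is_derive_inv (zn Mq) (is_derive_coord q v 2)))).
by have := zn Mq; rewrite /zc; move: (q 0 2) (twist q) => x y x0; field.
Qed.

(** The two functions are the coordinates of [(c, s)] rotated by the angle
    [- a z^2], which by hypothesis turns at the opposite rate to [(c, s)]. *)
Lemma untwisted_constant (a : R) (phi := fun q : point => a * zc q ^+ 2) :
  (forall p, M p -> twist p = 2 * a * zc p) -> forall p q, M p -> M q ->
  c p * cos (phi p) + s p * sin (phi p)
    = c q * cos (phi q) + s q * sin (phi q) /\
  s p * cos (phi p) - c p * sin (phi p)
    = s q * cos (phi q) - c q * sin (phi q).
Proof.
move=> tw p q Mp Mq.
have ders m v : M m -> exists w, [/\ is_derive m v c (- s m * w),
    is_derive m v s (c m * w),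
    is_derive m v (fun m => cos (phi m)) (- sin (phi m) * w) &
    is_derive m v (fun m => sin (phi m)) (cos (phi m) * w)].
  move=> Mm; exists (a * (2 * zc m * v 0 2)).
  have dc := smooth_diff sc Mm; have ds := smooth_diff ss Mm.
  have [ez fz] := partials_of_twist Mm.
  have dphi : is_derive m v phi (a * (2 * zc m * v 0 2)).
    apply: (is_derive_eq (is_derive_mul (is_derive_const a m v)
      (is_derive_sqr (is_derive_coord m v 2)))).
    by rewrite mulr0 addr0.
  split.
  - apply: (is_derive_eq (is_derive_diff v dc)).
    by rewrite derive_partials // sum3E cx0 // cy0 // ez tw //; ring.
  - apply: (is_derive_eq (is_derive_diff v ds)).
    by rewrite derive_partials // sum3E sx0 // sy0 // fz tw //; ring.
  - exact: is_derive_chain dphi (is_derive_cos _).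
  - exact: is_derive_chain dphi (is_derive_sin _).
split.
- apply: (gradient0_constant cM oM
    (f := fun m => c m * cos (phi m) + s m * sin (phi m))) => // m v Mm.
  have [w [h1 h2 h3 h4]] := ders m v Mm.
  apply: (is_derive_eq (is_derive_add (is_derive_mul h1 h3)
    (is_derive_mul h2 h4))).
  by ring.
- apply: (gradient0_constant cM oM
    (f := fun m => s m * cos (phi m) - c m * sin (phi m))) => // m v Mm.
  have [w [h1 h2 h3 h4]] := ders m v Mm.
  apply: (is_derive_eq (is_derive_add (is_derive_mul h2 h3)
    (is_derive_opp (is_derive_mul h1 h4)))).
  by ring.
Qed.

Theorem vertical_case :
  (forall p, M p -> exists t, c p = cos t /\ s p = sin t) ->
  exists p q : R, forall m, M m -> sigma m = sigma_pq p q m.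
Proof.
move=> ang; have [[p0 Mp0]|M0] := pselect (M !=set0); last first.
  by exists 0, 0 => p Mp; case: M0; exists p.
have [k tw] := twist_proportional; have [t [ct st]] := ang p0 Mp0.
pose a := k / 2; pose phi (m : point) := a * zc m ^+ 2.
have tw' p : M p -> twist p = 2 * a * zc p.
  by move=> Mp; rewrite tw // /a; field.
(* [t] is an angle of the field at [p0] *)
exists a, (t - phi p0) => m Mm; have [e1 e2] := untwisted_constant tw' Mm Mp0.
rewrite -/(phi m) -/(phi p0) ct st in e1 e2.
rewrite (mulrC (cos t)) (mulrC (sin t)) in e1 e2.
have eA : cos (t - phi p0) = c m * cos (phi m) + s m * sin (phi m).
  by rewrite e1 cosB; ring.
have eB : sin (t - phi p0) = s m * cos (phi m) - c m * sin (phi m).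
  by rewrite e2 sinB; ring.
have [_ _ -> // _ _] := hc.
rewrite /sigma_pq -/(phi m); move: (t - phi p0) eA eB => q eA eB.
rewrite cosD sinD eA eB.
have := cos2Dsin2 (phi m); move: (cos _) (sin _) => C S u.
congr (_ *: _ + _ *: _).
- transitivity (c m * (C ^+ 2 + S ^+ 2)); first by rewrite u mulr1.
  by ring.
- transitivity (s m * (C ^+ 2 + S ^+ 2)); first by rewrite u mulr1.
  by ring.
Qed.

End VerticalCase.
End Components.

End Classification.

Unset Implicit Arguments.

Theorem theorem1 (R : realType) (M : set 'rV[R]_3) (sigma : 'rV[R]_3 -> 'rV[R]_3)
    (MH3 : M `<=` H3) (openM : open M) (connectedM : connected M)
    (horo : horospherical M sigma) (harm : harmonic_unit_field M sigma) :
  (locally_angle depends_only_on_xy M sigma ->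
     [\/ invariant_field M sigma,
         translate_of theta_hat M sigma |
         translate_of (fun p => - theta_hat p) M sigma]) /\
  (locally_angle depends_only_on_z M sigma ->
     exists p q : R, forall m, M m -> sigma m = sigma_pq p q m).
Proof.
have [c [s hc]] := harmonic_componentsP MH3 openM horo harm.
split=> la.
  have inv : forall p, M p -> partial 2 c p = 0 /\ partial 2 s p = 0.
    apply: (partial_angle0 MH3 hc) la => U u p h [v uv] Up Uh.
    by rewrite !uv // /xc /yc !mxE ?ord3_eqE /= !mulr0 !add0r.
  by apply: (plane_case MH3 openM connectedM hc) => p /inv [].
have inv i : i != 2 -> forall p, M p -> partial i c p = 0 /\ partial i s p = 0.
  move=> i2; apply: (partial_angle0 MH3 hc) la => U u p h [v uv] Up Uh.
  by rewrite !uv // /zc !mxE eq_sym (negbTE i2) !mulr0 !add0r.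
apply: (vertical_case MH3 openM connectedM hc).
- by move=> p /(inv 0 isT) [].
- by move=> p /(inv 1 isT) [].
- by move=> p /(inv 0 isT) [].
- by move=> p /(inv 1 isT) [].
move=> p Mp.
have [U [u [_ Up _ _ csE]]] := locally_angle_components MH3 hc Mp la.
by exists (u p); exact: csE.
Qed.
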